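(* Let $R$ be a non-trivial valuation convexoid ring with fractional field $Q(R)$ weakly isomorphic to $\mathbb{Q}$ and with $1\boxplus 1$ invertible. Then $R$ is either (1) the local ring $\mathbb{Z}_{(p)}$ at a finite place $p\neq 2$, with $\boxplus=+$, or (2) the unit disk $\mathbf{D}\mathbb{Q}=\{x\in\mathbb{Q}\mid |x|_\infty\le 1\}$, with $a\boxplus b=\pm(a+b)/2$.
   Context: A convexoid is $(G,\boxplus,-,0)$ with $\boxplus$ a binary operation, $-$ a unary operation, $0$ a constant, such that $\boxplus$ is symmetric ($a\boxplus b=b\boxplus a$), all operations commute with each other (i.e. $(a\boxplus b)\boxplus(c\boxplus d)=(a\boxplus c)\boxplus(b\boxplus d)$, $-(a\boxplus b)=(-a)\boxplus(-b)$, $0\boxplus0=0$, $-0=0$), and $a\boxplus(-a)=0$. A convexoid ring is a monoid object in convexoids, i.e. a convexoid with an associative multiplication with unit $1$ such that left and right multiplications by elements are convexoid homomorphisms. Its fundamental constant is $\gamma=1\boxplus0$. All convexoid rings are assumed commutative with $\gamma$ a non-zero-divisor. A ring is regarded as a convexoid ring with $\boxplus=+$; in particular so is $\mathbb{Q}$. A map $f:A\to B$ of convexoid rings is a weak homomorphism if it is a homomorphism of multiplicative monoids, $\gamma_Bf(a\boxplus b)=f(\gamma_A)(f(a)\boxplus f(b))$ for all $a,b$, and $\gamma_B$ and $f(\gamma_A)$ generate the same ideal of $B$; a weak isomorphism is an invertible weak homomorphism. Through the weak isomorphism of $Q(R)$ with $\mathbb{Q}$, $R$ is regarded as a subset of $\mathbb{Q}$.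 A commutative convexoid ring is integral if $0$ is a prime ideal; its fractional field $Q(R)$ is defined as for rings (localization at the nonzero elements). An integral convexoid ring $R$ is a valuation convexoid ring if for every nonzero $x\in Q(R)$, either $x\in R$ or $x^{-1}\in R$; it is non-trivial if $R\neq Q(R)$. Here $|\cdot|_\infty$ is the usual absolute value on $\mathbb{Q}$.
   Formalization: In case (1), ''⊞ = +'' is proved up to weak isomorphism: R = Z_(p) as a subset of Q and a⊞b = γ(a+b) with γ a unit of Z_(p); literal equality fails for Z_(3) with a⊞b = 2(a+b), and it is recovered when γ = 1. *)

(* Defs.v *)
From HB Require Import structures.
From mathcomp Require Import all_boot all_order all_algebra.
From mathcomp Require Import boolp classical_sets.
From mathcomp Require Import ring.

Set Implicit Arguments.
Unset Strict Implicit.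
Unset Printing Implicit Defensive.

Import Order.TTheory GRing.Theory Num.Theory.
Local Open Scope quotient_scope.
Local Open Scope group_scope.

Reserved Notation "x ⊞ y" (at level 50, left associativity).
Reserved Notation "⊟ x" (at level 35, right associativity).

(* "All operations commute with each other": the pairs not listed below, (-, -)
   and (0, 0), give no condition. *)
HB.mixin Record isConvexoid G of Choice G := {
  cadd : G -> G -> G;
  copp : G -> G;
  czero : G;
  caddC : commutative cadd;
  caddACA : interchange cadd cadd;
  coppD : {morph copp : x y / cadd x y};
  cadd00 : cadd czero czero = czero;
  copp0 : copp czero = czero;
  caddN : forall x, cadd x (copp x) = czero
}.

#[short(type="convexoidType")]
HB.structure Definition Convexoid := {G of isConvexoid G & Choice G}.

Notation "x ⊞ y" := (cadd x y) : group_scope.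
Notation "⊟ x" := (copp x) : group_scope.

Definition convexoid_morphism (G H : convexoidType) (f : G -> H) : Prop :=
  [/\ {morph f : x y / x ⊞ y}, {morph f : x / ⊟ x} & f czero = czero].

HB.structure Definition ConvexoidMonoid := {R of Convexoid R & Monoid R}.

HB.mixin Record Convexoid_isConvexoidRing R of ConvexoidMonoid R := {
  mull_convexoid : forall a : R, convexoid_morphism (fun x : R => a * x);
  mulr_convexoid : forall a : R, convexoid_morphism (fun x : R => x * a)
}.

#[short(type="convexoidRingType")]
HB.structure Definition ConvexoidRing :=
  {R of Convexoid_isConvexoidRing R & ConvexoidMonoid R}.

Definition gamma {R : convexoidRingType} : R := 1 ⊞ czero.

(* A convexoid has no subtraction: "gamma is a non-zero-divisor" means that
   multiplication by gamma is injective, which is what is needed for R to embed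
   into its localizations. *)
HB.mixin Record ConvexoidRing_isCom R of ConvexoidRing R := {
  cmulC : forall a b : R, a * b = b * a;
  gamma_inj : injective (fun x : R => gamma * x)
}.

#[short(type="comConvexoidRingType")]
HB.structure Definition ComConvexoidRing :=
  {R of ConvexoidRing_isCom R & ConvexoidRing R}.

Section ConvexoidRingTheory.
Variable R : comConvexoidRingType.
Implicit Types a b c : R.

Lemma cmulDr a b c : a * (b ⊞ c) = (a * b) ⊞ (a * c).
Proof. by case: (mull_convexoid a) => ->. Qed.

Lemma cmulN a b : a * (⊟ b) = ⊟ (a * b).
Proof. by case: (mull_convexoid a) => _ ->. Qed.

Lemma cmul0 a : a * czero = czero.
Proof. by case: (mull_convexoid a) => _ _ ->. Qed.

Lemma cmulCA a b c : a * (b * c) = b * (a * c).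
Proof. by rewrite !mulgA (cmulC a). Qed.

Lemma cmulACA : @interchange R *%g *%g.
Proof. by move=> a b c d; rewrite -!mulgA (cmulCA b). Qed.

Lemma cm_step a b c d : c = a * d -> b = d -> a * b = c.
Proof. by move=> -> ->. Qed.

Lemma cm_pull a b c d : c = a * d -> b * c = a * (b * d).
Proof. by move=> ->; apply: cmulCA. Qed.

Definition invertible a := exists b, a * b = 1.

Definition is_ideal (I : set R) :=
  [/\ I czero, forall a b, I a -> I b -> I (a ⊞ b), forall a, I a -> I (⊟ a)
    & forall a b, I b -> I (a * b)].

(* the smallest ideal containing a *)
Definition ideal_gen a : set R :=
  [set b | forall I : set R, is_ideal I -> I a -> I b].

Definition prime_ideal (I : set R) :=
  [/\ is_ideal I, ~ I 1 & forall a b, I (a * b) -> I a \/ I b].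

Definition integral := prime_ideal [set czero].

End ConvexoidRingTheory.

Arguments integral R : clear implicits.

(* equality of products up to associativity and commutativity *)
Ltac cm_pull_tac :=
  first [reflexivity | apply: cmulC | apply: cm_pull; cm_pull_tac].
Ltac cm_steps :=
  first [reflexivity | apply: cm_step; [cm_pull_tac | cm_steps]].
Ltac cm := rewrite -?mulgA; cm_steps.

Definition convexoid_ring_iso (A B : comConvexoidRingType) (f : A -> B) : Prop :=
  [/\ convexoid_morphism f, monoid.monoid_morphism f & bijective f].

Definition weak_hom (A B : comConvexoidRingType) (f : A -> B) : Prop :=
  [/\ monoid.monoid_morphism f,
      forall a b, gamma * f (a ⊞ b) = f gamma * (f a ⊞ f b)
    & ideal_gen (gamma : B) = ideal_gen (f gamma)].

Definition weak_iso (A B : comConvexoidRingType) (f : A -> B) : Prop :=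
  weak_hom f /\ exists g : B -> A, [/\ cancel f g, cancel g f & weak_hom g].

Record mul_set (R : comConvexoidRingType) := MulSet {
  mul_set_set :> set R;
  mul_set1 : mul_set_set 1;
  mul_setM : forall a b, mul_set_set a -> mul_set_set b -> mul_set_set (a * b)
}.

Section Localization.
Variables (R : comConvexoidRingType) (S : mul_set R).

Definition denom := {s : R | s \in mul_set_set S}.

Let den1_subproof : 1 \in mul_set_set S.
Proof. by rewrite inE; apply: mul_set1. Qed.
Definition den1 : denom := Sub 1 den1_subproof.

Let denM_subproof (s t : denom) : val s * val t \in mul_set_set S.
Proof.
by rewrite inE; apply: mul_setM; [case: s|case: t] => ? /=; rewrite inE.
Qed.
Definition denM (s t : denom) : denom := Sub (val s * val t) (denM_subproof s t).

(* a / s = b / t iff u t a = u s b for some denominator u. *)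
Definition loc_rel (x y : R * denom) : bool :=
  `[< exists u : denom,
        val u * (val y.2 * x.1) = val u * (val x.2 * y.1) >].

Let loc_rel_refl : reflexive loc_rel.
Proof. by move=> x; apply/asboolP; exists den1. Qed.

Let loc_rel_sym : symmetric loc_rel.
Proof. by move=> x y; apply/asboolP/asboolP => -[u e]; exists u. Qed.

Let loc_rel_trans : transitive loc_rel.
Proof.
move=> [b t] [a s] [c r] /asboolP[u /= e1] /asboolP[v /= e2]; apply/asboolP.
exists (denM (denM u v) t) => /=.
transitivity (val v * val r * (val u * (val t * a))); first by cm.
rewrite e1.
transitivity (val u * val s * (val v * (val r * b))); first by cm.
by rewrite e2; cm.
Qed.

Canonical loc_equiv := EquivRel loc_rel loc_rel_refl loc_rel_sym loc_rel_trans.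

Definition localization := {eq_quot loc_equiv}.

HB.instance Definition _ : EqQuotient _ loc_rel localization :=
  EqQuotient.on localization.
HB.instance Definition _ := Choice.on localization.

Definition frac (a : R) (s : denom) : localization := \pi_localization (a, s).

Lemma fracP a s b t :
  frac a s = frac b t <->
  exists u : denom, val u * (val t * a) = val u * (val s * b).
Proof.
split; first by move/eqmodP/asboolP.
by move=> h; apply/eqmodP/asboolP.
Qed.

Lemma fracW (P : localization -> Prop) :
  (forall a s, P (frac a s)) -> forall x, P x.
Proof. by move=> h; elim/quotW => -[a s]; apply: h. Qed.

Let num (x : localization) : R := (repr x).1.
Let den (x : localization) : denom := (repr x).2.

Let frac_repr x : frac (num x) (den x) = x.
Proof. by rewrite /frac /num /den -surjective_pairing reprK. Qed.

Definition loc_add (x y : localization) : localization :=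
  frac ((val (den y) * num x) ⊞ (val (den x) * num y)) (denM (den x) (den y)).
Definition loc_opp (x : localization) : localization :=
  frac (⊟ (num x)) (den x).
Definition loc_mul (x y : localization) : localization :=
  frac (num x * num y) (denM (den x) (den y)).

Lemma loc_addE a s b t :
  loc_add (frac a s) (frac b t) = frac ((val t * a) ⊞ (val s * b)) (denM s t).
Proof.
have /fracP[u /= e] := frac_repr (frac a s).
have /fracP[v /= f] := frac_repr (frac b t).
rewrite /loc_add; apply/fracP; exists (denM u v) => /=.
move: (num _) (den _) e (num _) (den _) f => a' s' e b' t' f.
rewrite !cmulDr; congr (_ ⊞ _).
  transitivity (val v * (val t' * val t) * (val u * (val s * a'))); first by cm.
  by rewrite e; cm.
transitivity (val u * (val s' * val s) * (val v * (val t * b'))); first by cm.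
by rewrite f; cm.
Qed.

Lemma loc_oppE a s : loc_opp (frac a s) = frac (⊟ a) s.
Proof.
have /fracP[u /= e] := frac_repr (frac a s).
by rewrite /loc_opp; apply/fracP; exists u; rewrite !cmulN e.
Qed.

Lemma loc_mulE a s b t :
  loc_mul (frac a s) (frac b t) = frac (a * b) (denM s t).
Proof.
have /fracP[u /= e] := frac_repr (frac a s).
have /fracP[v /= f] := frac_repr (frac b t).
rewrite /loc_mul; apply/fracP; exists (denM u v) => /=.
move: (num _) (den _) e (num _) (den _) f => a' s' e b' t' f.
transitivity ((val u * (val s * a')) * (val v * (val t * b'))); first by cm.
by rewrite e f; cm.
Qed.

Lemma frac_eq_simpl a s b t : val t * a = val s * b -> frac a s = frac b t.
Proof. by move=> e; apply/fracP; exists den1; rewrite e. Qed.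

Let zero : localization := frac czero den1.
Let one : localization := frac 1 den1.

Let addC : commutative loc_add.
Proof.
elim/fracW => a s; elim/fracW => b t; rewrite !loc_addE.
by apply: frac_eq_simpl; rewrite /= caddC (cmulC (val t) (val s)).
Qed.

Let addACA : interchange loc_add loc_add.
Proof.
elim/fracW => a s; elim/fracW => b t; elim/fracW => c r; elim/fracW => d q.
rewrite !loc_addE; apply: frac_eq_simpl => /=; rewrite cmulACA; congr (_ * _).
by rewrite !cmulDr caddACA; congr ((_ ⊞ _) ⊞ (_ ⊞ _)); cm.
Qed.

Let oppD : {morph loc_opp : x y / loc_add x y}.
Proof.
elim/fracW => a s; elim/fracW => b t.
by rewrite !(loc_addE, loc_oppE) coppD -!cmulN.
Qed.

Let add00 : loc_add zero zero = zero.
Proof.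
rewrite loc_addE; apply: frac_eq_simpl => /=.
by rewrite !cmulDr !cmul0 cadd00.
Qed.

Let opp0 : loc_opp zero = zero.
Proof. by rewrite loc_oppE copp0. Qed.

Let addN x : loc_add x (loc_opp x) = zero.
Proof.
elim/fracW: x => a s; rewrite loc_oppE loc_addE cmulN caddN.
by apply: frac_eq_simpl; rewrite /= !cmul0.
Qed.

HB.instance Definition _ := isConvexoid.Build localization
  addC addACA oppD add00 opp0 addN.

Let mulC : commutative loc_mul.
Proof.
elim/fracW => a s; elim/fracW => b t; rewrite !loc_mulE.
by apply: frac_eq_simpl; rewrite /= (cmulC a) (cmulC (val t)).
Qed.

Let mulA : associative loc_mul.
Proof.
elim/fracW => a s; elim/fracW => b t; elim/fracW => c r; rewrite !loc_mulE.
by apply: frac_eq_simpl; rewrite /= !mulgA.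
Qed.

Let mul1 : left_id one loc_mul.
Proof.
elim/fracW => a s; rewrite loc_mulE.
by apply: frac_eq_simpl; rewrite /= !mul1g.
Qed.

Let mul1' : right_id one loc_mul.
Proof. by move=> x; rewrite mulC mul1. Qed.

HB.instance Definition _ := isMonoid.Build localization mulA mul1 mul1'.

Let mull x : convexoid_morphism (loc_mul x).
Proof.
elim/fracW: x => a s; split.
- elim/fracW => b t; elim/fracW => c r.
  rewrite ![_ ⊞ _]loc_addE !loc_mulE [RHS]loc_addE.
  apply: frac_eq_simpl => /=.
  by rewrite !cmulDr; congr (_ ⊞ _); cm.
- by elim/fracW => b t; rewrite ![⊟ _]loc_oppE !loc_mulE [RHS]loc_oppE cmulN.
- by rewrite loc_mulE; apply: frac_eq_simpl; rewrite /= !cmul0.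
Qed.

Let mulr x : convexoid_morphism (loc_mul^~ x).
Proof.
have [hD hN h0] := mull x.
split=> [y z|y|]; rewrite !(mulC _ x); first exact: hD; first exact: hN.
exact: h0.
Qed.

HB.instance Definition _ :=
  Convexoid_isConvexoidRing.Build localization mull mulr.

Let gammaE : @gamma localization = frac gamma den1.
Proof.
rewrite /gamma [LHS]loc_addE.
by apply: frac_eq_simpl; rewrite /= !mul1g.
Qed.

Let gammaI : injective ( *%g (@gamma localization)).
Proof.
rewrite gammaE; elim/fracW => a s; elim/fracW => b t.
move=> h; have {h} : loc_mul (frac gamma den1) (frac a s) =
  loc_mul (frac gamma den1) (frac b t) by [].
rewrite !loc_mulE => /fracP[u /= e]; apply/fracP; exists u.
apply: (@gamma_inj R) => /=; move: e; rewrite !mul1g => e.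
transitivity (val u * (val t * (gamma * a))); first by cm.
by rewrite e; cm.
Qed.

HB.instance Definition _ := ConvexoidRing_isCom.Build localization mulC gammaI.

End Localization.

Section FractionalField.
Variables (R : comConvexoidRingType) (intR : integral R).

Let nz : set R := [set a | a <> czero].

Let nz1 : nz 1.
Proof. by case: intR. Qed.

Let nzM a b : nz a -> nz b -> nz (a * b).
Proof. by case: intR => _ _ h a0 b0 /h[]. Qed.

Definition nonzero : mul_set R := MulSet nz1 nzM.

Definition frac_field := localization nonzero.

HB.instance Definition _ := ComConvexoidRing.on frac_field.

Definition to_frac (a : R) : frac_field := frac a (den1 nonzero).

Definition in_ring (x : frac_field) : Prop := exists a, to_frac a = x.

Definition valuation_ring : Prop :=
  forall x : frac_field, x <> czero ->
    in_ring x \/ exists2 y : frac_field, x * y = 1 & in_ring y.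

Definition non_trivial : Prop := exists x : frac_field, ~ in_ring x.

End FractionalField.

(* A copy of A; for A a commutative ring it is a convexoid ring with ⊞ := +. *)
Definition ring_convexoid (A : Type) : Type := A.

Section RingConvexoid.
Variable A : comPzRingType.
Local Notation C := (ring_convexoid A).

HB.instance Definition _ := Choice.copy C A.
HB.instance Definition _ := isConvexoid.Build C (@addrC A) (@addrACA A)
  (@opprD A) (addr0 0%R) (@oppr0 A) (@addrN A).
HB.instance Definition _ := isMonoid.Build C (@mulrA A) (@mul1r A) (@mulr1 A).

Let mull (a : C) : convexoid_morphism ( *%g a).
Proof. by split=> [b c|b|]; [exact: mulrDr|exact: mulrN|exact: mulr0]. Qed.

Let mulr (a : C) : convexoid_morphism ( *%g^~ a).
Proof. by split=> [b c|b|]; [exact: mulrDl|exact: mulNr|exact: mul0r]. Qed.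

HB.instance Definition _ := Convexoid_isConvexoidRing.Build C mull mulr.

Let gammaI : injective ( *%g (@gamma C)).
Proof.
have -> : @gamma C = 1 by exact: (@addr0 A).
by move=> x y; rewrite !mul1g.
Qed.

HB.instance Definition _ := ConvexoidRing_isCom.Build C (@mulrC A) gammaI.

End RingConvexoid.

Local Open Scope ring_scope.

(* The rationals with denominator prime to p, Z_(p) for p prime. As a convexoid
   ring with ⊞ := +, it is weakly isomorphic, but for u <> 1 not isomorphic, to
   the same set with a ⊞ b := u (a + b), u a unit; the latter has gamma = u. *)
Definition zlocal_pred (p : nat) : {pred rat} :=
  [pred x | coprime p `|denq x|].

Lemma denq_dvd (x : rat) (m d : int) :
  d != 0 -> x = m%:~R / d%:~R -> (denq x %| d)%Z.
Proof.
move=> d0 ex; have d0' : d%:~R != 0 :> rat by rewrite intr_eq0.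
have e : numq x * d = m * denq x.
  by apply: (@intr_inj rat); rewrite !rmorphM /= numqE ex mulrAC divfK.
have : (denq x %| numq x * d)%Z by rewrite e dvdz_mull.
by rewrite Gauss_dvdzr // coprimezE coprime_sym coprime_num_den.
Qed.

Lemma zlocal_subring p : subring_closed (zlocal_pred p).
Proof.
have E (x y z : rat) (m : int) : x \in zlocal_pred p -> y \in zlocal_pred p ->
    z = m%:~R / (denq x * denq y)%:~R -> z \in zlocal_pred p.
  rewrite !inE => px py /denq_dvd h; apply: coprime_dvdr.
    by apply: h; rewrite mulf_neq0 ?denq_neq0.
  by rewrite abszM coprimeMr px.
split=> [|x y px py|x y px py]; first by rewrite inE /= coprimen1.
  apply: (E x y _ (numq x * denq y - numq y * denq x)) => //.
  rewrite rmorphB /= !rmorphM /= !numqE; field.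
  by rewrite !intr_eq0 !denq_neq0.
apply: (E x y _ (numq x * numq y)) => //.
rewrite !rmorphM /= !numqE; field.
by rewrite !intr_eq0 !denq_neq0.
Qed.

HB.instance Definition _ p :=
  GRing.isSubringClosed.Build rat (zlocal_pred p) (zlocal_subring p).

Record zlocal (p : nat) := ZLocal {
  zlocal_val :> rat;
  zlocal_valP : zlocal_val \in zlocal_pred p
}.

HB.instance Definition _ p := [isSub for @zlocal_val p].
HB.instance Definition _ p := [Choice of zlocal p by <:].
HB.instance Definition _ p := [SubChoice_isSubComNzRing of zlocal p by <:].

(* e is the sign in a ⊞ b = ± (a + b) / 2: + if e is false, - if it is true. *)
Record unit_disk (e : bool) := UnitDisk {
  disk_val :> rat;
  disk_valP : `|disk_val| <= 1
}.

Section UnitDisk.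
Variable e : bool.
Local Notation D := (unit_disk e).

HB.instance Definition _ := [isSub for @disk_val e].
HB.instance Definition _ := [Choice of D by <:].

Let add_subproof (x y : D) : `|(-1) ^+ e * ((disk_val x + disk_val y) / 2)| <= 1.
Proof.
rewrite normrM normr_sign mul1r normf_div normr_nat ler_pdivrMr //.
rewrite mul1r.
by apply: le_trans (ler_normD _ _) _; rewrite (@lerD _ _ 1 _ 1) // disk_valP.
Qed.
Definition disk_add (x y : D) : D := UnitDisk e (add_subproof x y).

Let opp_subproof (x : D) : `|- disk_val x| <= 1.
Proof. by rewrite normrN disk_valP. Qed.
Definition disk_opp (x : D) : D := UnitDisk e (opp_subproof x).

Let zero_subproof : `|0 : rat| <= 1. Proof. by rewrite normr0. Qed.
Definition disk_zero : D := UnitDisk e zero_subproof.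

Let mul_subproof (x y : D) : `|disk_val x * disk_val y| <= 1.
Proof. by rewrite normrM mulr_ile1 // disk_valP. Qed.
Definition disk_mul (x y : D) : D := UnitDisk e (mul_subproof x y).

Let one_subproof : `|1 : rat| <= 1. Proof. by rewrite normr1. Qed.
Definition disk_one : D := UnitDisk e one_subproof.

Let addC : commutative disk_add.
Proof. by move=> x y; apply: val_inj; rewrite /= [disk_val x + _]addrC. Qed.
Let addACA : interchange disk_add disk_add.
Proof. by move=> x y z t; apply: val_inj => /=; ring. Qed.
Let oppD : {morph disk_opp : x y / disk_add x y}.
Proof. by move=> x y; apply: val_inj => /=; ring. Qed.
Let add00 : disk_add disk_zero disk_zero = disk_zero.
Proof. by apply: val_inj => /=; ring. Qed.
Let opp0 : disk_opp disk_zero = disk_zero.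
Proof. by apply: val_inj => /=; ring. Qed.
Let addN x : disk_add x (disk_opp x) = disk_zero.
Proof. by apply: val_inj => /=; ring. Qed.

HB.instance Definition _ := isConvexoid.Build D
  addC addACA oppD add00 opp0 addN.

Let mulA : associative disk_mul.
Proof. by move=> x y z; apply: val_inj; rewrite /= mulrA. Qed.
Let mul1 : left_id disk_one disk_mul.
Proof. by move=> x; apply: val_inj; rewrite /= mul1r. Qed.
Let mul1' : right_id disk_one disk_mul.
Proof. by move=> x; apply: val_inj; rewrite /= mulr1. Qed.

HB.instance Definition _ := isMonoid.Build D mulA mul1 mul1'.

Let mull (a : D) : convexoid_morphism (fun x : D => (a * x)%g).
Proof. by split=> [x y|x|]; apply: val_inj => /=; ring. Qed.
Let mulr (a : D) : convexoid_morphism (fun x : D => (x * a)%g).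
Proof. by split=> [x y|x|]; apply: val_inj => /=; ring. Qed.

HB.instance Definition _ := Convexoid_isConvexoidRing.Build D mull mulr.

Let mulC (x y : D) : (x * y = y * x)%g.
Proof. by apply: val_inj; rewrite /= mulrC. Qed.

Let gammaI : injective (fun x : D => (gamma * x)%g).
Proof.
move=> x y /(congr1 (@disk_val e)) /= h; apply: val_inj; apply: mulfI h.
by rewrite mulf_neq0 ?signr_eq0.
Qed.

HB.instance Definition _ := ConvexoidRing_isCom.Build D mulC gammaI.

End UnitDisk.

(* Main.v *)
Require Import Defs.
From HB Require Import structures.
From mathcomp Require Import all_boot all_order all_algebra.
From mathcomp Require Import boolp classical_sets.
From mathcomp Require Import ring lra zify.

(** Everything takes place inside the rationals. Let A be the image of R and u the
image of gamma. The weak homomorphism property turns the operation of R into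
u * (x + y), so A is a multiplicative submonoid of the rationals, stable under
negation and under (x, y) |-> u * (x + y); for every nonzero
rational it contains that rational or its inverse, it is not everything, and 2 * u, the image of 1 ⊞ 1, is a unit of A.
The question is whether u itself is a unit of A ([valuation_dichotomy]).

If it is, dividing by u shows that A is stable under addition. So A is a proper
valuation subring of the rationals. The least positive p with 1/p outside A is
prime, and A is the set of rationals with denominator prime to p
([valuation_subring]); p is odd because 2 = (2 * u) / u is a unit.

If it is not, then 2 does not belong to A, since otherwise u^-1 = 2 / (2 * u)
would. On the other hand (x + y) / 2 = u * (x + y) / (2 * u), so A is stable
under midpoints. From 0, x and m * x, repeated midpoints reach all of
x, 2 * x, ..., m * x ([midpoint_segment]). With x = 1 this shows that A contains
no integer above 1, hence, by the valuation property, all the 1/m; with x = 1/m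
it then shows that A contains all rationals of the unit disk. A member x of A
outside the disk would have a power of absolute value at least 2, and 2 would be
the product of that power and of a member of the disk. So A is the unit disk
([midpoint_disk]), whose units are 1 and -1, and 2 * u is one of them.

It remains to translate this back. The map from R to its fractional field is
injective because multiplication by gamma is, so R is in bijection with A; and
a bijective weak homomorphism is a weak isomorphism ([weak_hom_bij]). *)

Set Implicit Arguments.
Unset Strict Implicit.
Unset Printing Implicit Defensive.

Import Order.TTheory GRing.Theory Num.Theory.
Local Open Scope ring_scope.

(** * Multiplicative valuation submonoids of the rationals *)

Section RationalValuations.

Variable A : rat -> Prop.
Hypothesis A1 : A 1.
Hypothesis AN : forall x, A x -> A (- x).
Hypothesis AM : forall x y, A x -> A y -> A (x * y).
Hypothesis A_val : forall x, x != 0 -> A x \/ A x^-1.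

Lemma valuation_exp x n : A x -> A (x ^+ n).
Proof.
by move=> Ax; elim: n => [|n IHn]; rewrite ?expr0 // exprS; apply: AM.
Qed.

Section Subring.

Hypothesis AD : forall x y, A x -> A y -> A (x + y).

Lemma subring_int (m : int) : A m%:~R.
Proof.
have An n : A n%:R.
  elim: n => [|n IHn]; first by rewrite -[0%:R](subrr 1); apply/AD/AN.
  by rewrite -natr1; apply: AD.
by case: m => n; rewrite ?NegzE ?rmorphN /=; [exact: An | apply/AN/An].
Qed.

(** Bezout: if a * p + b * n = 1, then x = a * (p * x) + b * (n * x). *)
Lemma subring_coprime (p : nat) (n : int) (x : rat) :
  coprime p `|n| -> A (n%:~R * x) -> A (p%:R * x) -> A x.
Proof.
move=> cop An Ap; have /coprimezP[[a b] /= e] : coprimez p n by [].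
rewrite -[x]mul1r -[1]/(1%:~R) -e rmorphD !rmorphM /= mulrDl -!mulrA.
by apply: AD; apply: AM => //; apply: subring_int.
Qed.

(** The least positive p with 1/p outside A exists because A contains the
integers and is not everything; it is prime, since 1/p is the product of the
inverses of the factors of p. No member of A has a denominator divisible by p:
clearing the rest of the denominator and using Bezout would put 1/p in A.
Conversely, let d be prime to p. If d/p were in A, so would be 1/p, by Bezout;
so A contains p/d, and, by Bezout again, 1/d. *)
Lemma valuation_subring :
  (exists x, ~ A x) ->
  exists2 p : nat, prime p & forall x, A x <-> x \in zlocal_pred p.
Proof.
move=> [x0 nAx0].
have : exists n : nat, `[< (0 < n)%N /\ ~ A n%:R^-1 >].
  exists `|denq x0|%N; apply/asboolP; split; first by rewrite absz_gt0 denq_neq0.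
  move=> Ad; apply: nAx0; rewrite -[x0]divq_num_den; apply: AM.
    exact: subring_int.
  by move: Ad; rewrite natr_absz gtr0_norm ?denq_gt0.
case/ex_minnP => p /asboolP[p_gt0 nAp] p_min.
have Alt n : (0 < n < p)%N -> A n%:R^-1.
  case/andP => n0 np; apply: contrapT => nAn.
  by have := p_min n (introT (asboolP _) (conj n0 nAn)); rewrite leqNgt np.
have pr : prime p.
  have p1 : (1 < p)%N.
    by case: (p) p_gt0 nAp => [|[|]] // _ []; rewrite invr1.
  apply/primeP; split=> // d dp; apply: contrapT => /negP; rewrite negb_or.
  case/andP => d1 dnp; apply: nAp; rewrite -(divnK dp) natrM invfM.
  have d0 : (0 < d)%N by apply: dvdn_gt0 dp.
  have dlt : (d < p)%N by rewrite ltn_neqAle dnp dvdn_leq.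
  apply: AM; apply: Alt; rewrite ?d0 ?divn_gt0 ?(ltnW dlt) //=.
  by rewrite ltn_Pdiv // ltn_neqAle eq_sym d1.
have p0 : p%:R != 0 :> rat by rewrite pnatr_eq0 -lt0n.
exists p => // x; rewrite inE /=; split=> [Ax | cop].
  rewrite prime_coprime //; apply/negP => /dvdnP[d ed]; apply: nAp.
  have cop : coprime p `|numq x|.
    rewrite prime_coprime //; apply/negP => pn.
    have := coprime_num_den x; rewrite /coprime => /eqP g1.
    have : (p %| gcdn `|numq x| `|denq x|)%N by rewrite dvdn_gcd pn ed dvdn_mull.
    by rewrite g1 dvdn1 => /eqP p1; move: pr; rewrite p1.
  apply: (subring_coprime cop); last by rewrite mulfV.
  suff -> : (numq x)%:~R * p%:R^-1 = d%:R * x :> rat.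
    by apply: AM => //; apply: (subring_int d).
  have -> : (numq x)%:~R = x * (d * p)%:R.
    by rewrite -ed natr_absz gtr0_norm ?denq_gt0 // numqE.
  by rewrite natrM mulrA mulfK // mulrC.
rewrite -[x]divq_num_den; apply: AM; first exact: subring_int.
have d0 : (denq x)%:~R != 0 :> rat by rewrite intr_eq0 denq_neq0.
apply: (subring_coprime cop); first by rewrite mulfV.
have [|h] := A_val (mulf_neq0 d0 (invr_neq0 p0)).
  by move=> h; case: nAp; apply: (subring_coprime cop); rewrite ?mulfV.
by move: h; rewrite invfM invrK mulrC.
Qed.

End Subring.

Section Midpoint.

Hypothesis Amid : forall x y, A x -> A y -> A ((x + y) / 2).
Hypothesis nA2 : ~ A 2.

Lemma midpoint0 : A 0.
Proof.
have : A ((1 + -1) / 2) by apply: Amid => //; apply: AN.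
by rewrite subrr mul0r.
Qed.

(** If c is an integer midpoint of a and b, and a * x and b * x are in A, so is
c * x. Starting from 0, 1 and m this reaches every j <= m: the midpoint of m with
0 or 1 is the upper half of m, below which one descends on m; a larger j < m is
the midpoint of m and of 2 * j - m, which is smaller than j. *)
Lemma midpoint_segment (x : rat) (m j : nat) :
  A x -> A (m%:R * x) -> (j <= m)%N -> A (j%:R * x).
Proof.
move=> Ax; have half (a b c : nat) : (a + b = c + c)%N ->
    A (a%:R * x) -> A (b%:R * x) -> A (c%:R * x).
  move=> e Aa Ab; suff -> : c%:R * x = (a%:R * x + b%:R * x) / 2 by apply: Amid.
  by rewrite -mulrDl -natrD e natrD; field.
have A0 : A (0%:R * x) by rewrite mul0r; apply: midpoint0.
elim/ltn_ind: m j => m IHm j Am.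
have [m_le1|m_gt1] := leqP m 1.
  by move=> jm; have [->|->] : j = 0%N \/ j = m by lia.
have hE : (uphalf m + uphalf m = m + odd m)%N.
  by rewrite addnn -[m in RHS]odd_double_half uphalf_half doubleD; case: odd; lia.
have Auphalf : A ((uphalf m)%:R * x).
  have [om|em] := boolP (odd m).
    by apply: (half m 1%N) => //; rewrite ?mul1r ?hE ?om.
  by apply: (half m 0%N); rewrite ?hE ?(negPf em).
elim/ltn_ind: j => j IHj jm.
have [jh|hj] := leqP j (uphalf m).
  by apply: (IHm (uphalf m)) => //; lia.
have [->//|jm'] := eqVneq j m.
by apply: (half m (2 * j - m)%N) => //; [lia | apply: IHj; lia].
Qed.

Lemma midpoint_nat (n : nat) : (1 < n)%N -> ~ A n%:R.
Proof.
move=> n1 An; apply: nA2; rewrite -[2]mulr1.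
by apply: (@midpoint_segment 1 n 2) => //; rewrite mulr1.
Qed.

(** A nonnegative rational of the disk is j * (1/m) with j <= m, and 1/m belongs to A
because m does not, unless m = 1. *)
Lemma midpoint_sub_disk x : `|x| <= 1 -> A x.
Proof.
wlog x0 : x / 0 <= x.
  move=> W; have [x_ge0|x_lt0] := leP 0 x; first exact: W.
  by rewrite -normrN -{2}[x]opprK => h; apply/AN/W => //; rewrite oppr_ge0 ltW.
rewrite ger0_norm // => x1.
have [d ed] : exists d : nat, denq x = d.+1.
  by case: (denq x) (denq_gt0 x) => [[|d]|] // _; exists d.
have [n en] : exists n : nat, numq x = n.
  by move: x0; rewrite -numq_ge0; case: (numq x) => // n _; exists n.
have ex : x = n%:R * d.+1%:R^-1 by rewrite -[x in LHS]divq_num_den ed en.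
have d0 : d.+1%:R != 0 :> rat by rewrite pnatr_eq0.
rewrite ex; apply: (@midpoint_segment _ d.+1); last 1 first.
- by rewrite -(ler_nat rat) -[d.+1%:R]mul1r -ler_pdivrMr ?ltr0n // -ex.
- case: d {ed ex} d0 => [|d] d0; first by rewrite invr1.
  by case: (A_val d0) => // /midpoint_nat-/(_ isT).
- by rewrite mulfV.
Qed.

(** If x is in A and |x| > 1, some power of x has absolute value at least 2, and 2
is the product of that power and of a rational of the disk. *)
Lemma midpoint_disk x : A x <-> `|x| <= 1.
Proof.
split; last exact: midpoint_sub_disk.
move=> Ax; rewrite leNgt; apply/negP => x1; apply: nA2.
(* Bernoulli's inequality, applied below with n >= 1 / (|x| - 1). *)
have bern n : 1 + n%:R * (`|x| - 1) <= `|x| ^+ n.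
  elim: n => [|n IHn]; first by rewrite mul0r addr0 expr0.
  have n0 : 0 <= n%:R :> rat by [].
  rewrite exprS -natr1; have := ler_wpM2l (normr_ge0 x) IHn.
  by have := mulr_ge0 n0 (sqr_ge0 (`|x| - 1)); rewrite expr2; lra.
have [n xn] : exists n, 2 <= `|x| ^+ n.
  exists (Num.bound (`|x| - 1)^-1); apply: le_trans (bern _).
  have x0 : 0 < `|x| - 1 by rewrite subr_gt0.
  have := @archi_boundP _ (`|x| - 1)^-1; rewrite invr_ge0 => /(_ (ltW x0)).
  by rewrite -div1r ltr_pdivrMr // => /ltW; lra.
have xn0 : x ^+ n != 0 by rewrite -normr_gt0 normrX; lra.
rewrite -[2](divfK xn0); apply: AM; last exact: valuation_exp.
apply: midpoint_sub_disk.
by rewrite normrM normfV normrX normr_nat ler_pdivrMr ?mul1r //; lra.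
Qed.

End Midpoint.

(** The two cases are u a unit of A and u not a unit of A; in the second one, the
units of the disk have absolute value 1, which determines u up to sign. *)
Lemma valuation_dichotomy (u : rat) :
    (exists x, ~ A x) -> (forall x y, A x -> A y -> A (u * (x + y))) ->
    A (2 * u)^-1 -> u != 0 ->
  (exists p : nat, [/\ prime p, p <> 2%N, A u^-1
     & forall x, A x <-> x \in zlocal_pred p])
  \/ (exists e : bool, u = (-1) ^+ e / 2 /\ forall x, A x <-> `|x| <= 1).
Proof.
move=> ntA Au A2u u0.
have A2u' : A (2 * u) by rewrite mulrC; apply: (Au 1 1).
have [AuV|nAuV] := pselect (A u^-1); [left | right].
  have AD x y : A x -> A y -> A (x + y).
    by move=> Ax Ay; rewrite -[x + y](mulKf u0); apply/AM/Au.
  have [p pr Ap] := valuation_subring AD ntA.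
  exists p; split=> // p2.
  have A0 : A 0 by rewrite -(subrr 1); apply: AD => //; apply: AN.
  have Au1 : A u by rewrite -[u]mulr1 -[1]addr0; apply: Au.
  have : A 2^-1 by have -> : 2^-1 = (2 * u)^-1 * u; [field | apply: AM].
  by rewrite Ap inE p2.
have nA2 : ~ A 2.
  move=> A2; apply: nAuV; have -> : u^-1 = 2 * (2 * u)^-1 by field.
  exact: AM.
have Amid x y : A x -> A y -> A ((x + y) / 2).
  move=> Ax Ay; have -> : (x + y) / 2 = (2 * u)^-1 * (u * (x + y)) by field.
  by apply/AM/Au.
have AE := midpoint_disk Amid nA2.
have : `|2 * u| = 1.
  apply/eqP; rewrite eq_le; apply/andP; split; first exact/AE.
  by move/AE: A2u; rewrite normfV invf_le1 // normr_gt0 mulf_neq0.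
move=> h; exists (2 * u < 0); split=> //.
have : 2 * u = (-1) ^+ (2 * u < 0)%R by rewrite [LHS]numEsign h mulr1.
by move=> <-; field.
Qed.

End RationalValuations.

(** * Cancellation and principal ideals in convexoid rings *)

Section ConvexoidRingFacts.

Local Open Scope group_scope.

Variable R : comConvexoidRingType.
Implicit Types a b c : R.

Lemma cmulDl a b c : (a ⊞ b) * c = (a * c) ⊞ (b * c).
Proof. by rewrite ![_ * c]cmulC cmulDr. Qed.

Lemma cadd0 a : a ⊞ czero = gamma * a.
Proof. by rewrite cmulDl mul1g [czero * a]cmulC cmul0. Qed.

(** Add 0 ⊞ b to a ⊞ ⊟ b = 0 and exchange the middle terms: the result is
(a ⊞ 0) ⊞ (⊟ b ⊞ b), that is gamma * (gamma * a), on the one hand, and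
gamma * (gamma * b) on the other hand. *)
Lemma csub_eq0 a b : a ⊞ ⊟ b = czero -> a = b.
Proof.
move=> e; apply: (@gamma_inj R) => /=; apply: (@gamma_inj R) => /=.
have := caddACA a (⊟ b) czero b; rewrite e [⊟ b ⊞ b]caddC caddN.
by rewrite !cadd0 [czero ⊞ _]caddC !cadd0 [czero ⊞ _]caddC cadd0.
Qed.

Lemma integral_mulI a : integral R -> a <> czero -> injective ( *%g a).
Proof.
case=> _ _ int a0 b c e; apply: csub_eq0.
by case: (int a (b ⊞ ⊟ c)) => //; rewrite /= cmulDr cmulN e caddN.
Qed.

Lemma ideal_genP a b : ideal_gen a b <-> exists c, b = c * a.
Proof.
split=> [h|[c ->] I [_ _ _ IM] Ia]; last exact: IM.
apply: (h [set x | exists c, x = c * a]%classic); last by exists 1; rewrite mul1g.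
split=> [|x y [c ->] [d ->]|x [c ->]|x y [c ->]].
- by exists czero; rewrite cmulC cmul0.
- by exists (c ⊞ d); rewrite cmulDl.
- by exists (⊟ c); rewrite ![_ * a]cmulC cmulN.
- by exists (x * c); rewrite mulgA.
Qed.

End ConvexoidRingFacts.

(** * Bijective weak homomorphisms *)

Section WeakIso.

Local Open Scope group_scope.

(** Additivity of the inverse is read off after applying f. As for the ideals,
which are principal, f gamma and gamma divide each other in B, and the inverse
of f, being multiplicative, preserves divisibility. *)
Lemma weak_hom_bij (A B : comConvexoidRingType) (f : A -> B) :
  weak_hom f -> bijective f -> weak_iso f.
Proof.
move=> hf [k fK kK]; have [[f1 fM] fD fI] := hf; split=> //.
have kM : {morph k : x y / x * y}.
  by move=> x y; apply: (can_inj fK); rewrite fM !kK.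
have k1 : k 1 = 1 by rewrite -f1 fK.
exists k; split=> //; split=> // [x y|].
  by apply: (can_inj fK); rewrite !fM !kK fD !kK.
have [c ec] : exists c, gamma = c * f gamma.
  by apply/ideal_genP; rewrite -fI; apply/ideal_genP; exists 1; rewrite mul1g.
have [d ed] : exists d, f gamma = d * gamma.
  by apply/ideal_genP; rewrite fI; apply/ideal_genP; exists 1; rewrite mul1g.
apply/seteqP; split=> x /ideal_genP[y ->]; apply/ideal_genP.
  by exists (y * k d); rewrite -mulgA -kM -ed fK.
by exists (y * k c); rewrite -mulgA [in LHS]ec kM fK.
Qed.

End WeakIso.

(** * The embedding of an integral convexoid ring in its fractional field *)

Section FractionalFieldFacts.

Local Open Scope group_scope.

Variables (R : comConvexoidRingType) (intR : integral R).

Local Notation h := (to_frac intR).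

Lemma to_fracD : {morph h : a b / a ⊞ b}.
Proof.
move=> a b; rewrite [RHS]loc_addE; apply: frac_eq_simpl.
by rewrite /= !mul1g.
Qed.

Lemma to_frac_monoid : monoid.monoid_morphism h.
Proof.
split=> // a b; rewrite [RHS]loc_mulE; apply: frac_eq_simpl.
by rewrite /= !mul1g.
Qed.

Lemma to_frac_gamma : h gamma = gamma.
Proof. by rewrite to_fracD. Qed.

Lemma to_frac_inj : injective h.
Proof.
move=> a b /fracP[[u /= nzu]]; rewrite !mul1g; apply: integral_mulI => //.
by move: nzu; rewrite inE.
Qed.

End FractionalFieldFacts.

(** * The embedding of the convexoid ring in the rationals *)

Section RationalEmbedding.

Variables (R : comConvexoidRingType) (intR : integral R).
Variable f : frac_field intR -> ring_convexoid rat.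
Hypothesis f_iso : weak_iso f.

Definition rat_embed (a : R) : rat := f (to_frac intR a).
Local Notation h := rat_embed.
Local Notation u := (rat_embed gamma).

Lemma rat_embed_inj : injective h.
Proof.
by case: f_iso => _ [k [/can_inj fI _ _]] a b /fI; apply: to_frac_inj.
Qed.

Lemma rat_embed1 : h 1%g = 1.
Proof. by case: f_iso => [[[f1 _] _ _] _]. Qed.

Lemma rat_embedM a b : h (a * b)%g = h a * h b.
Proof.
have [[[_ fM] _ _] _] := f_iso.
by rewrite /h (to_frac_monoid intR).2 fM.
Qed.

Lemma rat_embedD a b : h (a ⊞ b)%g = u * (h a + h b).
Proof.
have [[_ fD _] _] := f_iso.
have := fD (to_frac intR a) (to_frac intR b); rewrite -to_fracD -to_frac_gamma.
have -> : @gamma (ring_convexoid rat) = 1%g by exact: (@addr0 rat).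
by rewrite mul1g.
Qed.

(** The image of 0 is idempotent, so it is 0 or 1, and 1 is the image of 1. *)
Lemma rat_embed0 : h czero = 0.
Proof.
have : h czero * h czero = h czero by rewrite -rat_embedM cmul0.
move/eqP; rewrite -subr_eq0 -{3}[h czero]mulr1 -mulrBr mulf_eq0 subr_eq0.
rewrite -rat_embed1; case/orP => /eqP // /rat_embed_inj e.
by have [_ n10 _] := intR; case: n10.
Qed.

Lemma rat_embed_gamma_neq0 : u != 0.
Proof.
apply/eqP; rewrite -rat_embed0 => /rat_embed_inj g0.
have [_ n10 _] := intR; apply: n10 => /=.
by apply: (@gamma_inj R); rewrite /= cmul0 mulg1.
Qed.

Lemma rat_embedN a : h (⊟ a)%g = - h a.
Proof.
have := rat_embedD a (⊟ a)%g; rewrite caddN rat_embed0 => /esym/eqP.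
by rewrite mulf_eq0 (negPf rat_embed_gamma_neq0) addrC addr_eq0 => /eqP.
Qed.

Lemma rat_embed_valuation :
  valuation_ring intR ->
  forall x, x != 0 -> (exists a, h a = x) \/ exists a, h a = x^-1.
Proof.
have [[[f1 fM] _ _] [k [fK kK _]]] := f_iso.
have f0 : f czero = 0 by exact: rat_embed0.
move=> valR x x0.
have kx0 : k x <> czero by move=> e; move: x0; rewrite -[x]kK e f0 eqxx.
have [[a ea]|[y e [a ea]]] := valR _ kx0; [left | right]; exists a; rewrite /h ea.
  exact: kK.
by apply: (mulfI x0); rewrite mulfV // -[1]f1 -e fM kK.
Qed.

Lemma rat_embed_non_trivial :
  non_trivial intR -> exists x, ~ exists a, h a = x.
Proof.
case: f_iso => _ [k [fK _ _]] [x nx]; exists (f x) => -[a ea]; apply: nx.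
by exists a; apply: (can_inj fK).
Qed.

End RationalEmbedding.

(** * Classification *)

Theorem theorem3p1 (R : comConvexoidRingType) (intR : integral R)
    (valR : valuation_ring intR) (ntR : non_trivial intR)
    (f : frac_field intR -> ring_convexoid rat) (f_iso : weak_iso f)
    (inv2 : invertible (1 ⊞ 1 : R)%g) :
  (exists p : nat,
     [/\ prime p, p <> 2%N &
         exists g : R -> ring_convexoid (zlocal p),
           weak_iso g /\ forall a : R, zlocal_val (g a) = f (to_frac intR a)])
  \/
  (exists (e : bool) (g : R -> unit_disk e),
     convexoid_ring_iso g /\
     forall a : R, disk_val (g a) = f (to_frac intR a)).
Proof.
pose h := rat_embed f; pose A x := exists a, h a = x.
have h1 : h 1%g = 1 by apply: rat_embed1.
have hM a b : h (a * b)%g = h a * h b by apply: rat_embedM.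
have hD a b : h (a ⊞ b)%g = h gamma * (h a + h b) by apply: rat_embedD.
have hN a : h (⊟ a)%g = - h a by apply: rat_embedN.
have h0 : h czero = 0 by apply: rat_embed0.
have hI : injective h by apply: rat_embed_inj.
have u0 : h gamma != 0 by apply: rat_embed_gamma_neq0.
have A1 : A 1 by exists 1%g.
have AN x : A x -> A (- x) by case=> a <-; exists (⊟ a)%g.
have AM x y : A x -> A y -> A (x * y) by case=> a <- [b <-]; exists (a * b)%g.
have Au x y : A x -> A y -> A (h gamma * (x + y)).
  by case=> a <- [b <-]; exists (a ⊞ b)%g.
have A2u : A (2 * h gamma)^-1.
  have [b e] := inv2; exists b; have := congr1 h e; rewrite hM hD h1 => e'.
  apply: (@mulfI _ (2 * h gamma)); first by rewrite mulf_neq0.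
  by rewrite mulfV ?mulf_neq0 // -[RHS]e'; ring.
have A_val := rat_embed_valuation f_iso valR.
have A_nt := rat_embed_non_trivial f_iso ntR.
have [] := valuation_dichotomy A1 AN AM A_val A_nt Au A2u u0.
  case=> p [pr p2 AuV AE]; left; exists p; split=> //.
  have hP a : h a \in zlocal_pred p by apply/AE; exists a.
  pose g a : ring_convexoid (zlocal p) := ZLocal (hP a).
  exists g; split=> //.
  have g_bij : bijective g.
    have gE (y : zlocal p) : exists a, h a == zlocal_val y.
      by have /AE[a <-] := zlocal_valP y; exists a.
    exists (fun y => xchoose (gE y)) => [a|y].
      by apply/hI/eqP; apply: (xchooseP (gE (g a))).
    by apply: val_inj; apply/eqP; apply: (xchooseP (gE y)).
  have gamma1 : @gamma (ring_convexoid (zlocal p)) = 1%g.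
    exact: (@addr0 (zlocal p)).
  apply: weak_hom_bij => //; split.
  - by split=> [|a b]; apply: val_inj; rewrite /= ?h1 ?hM.
  - by move=> a b; rewrite gamma1 mul1g; apply: val_inj; rewrite /= hD.
  have [c ec] := AuV.
  rewrite gamma1; apply/seteqP; split=> x /ideal_genP[y ->]; apply/ideal_genP.
    exists (y * g c)%g; rewrite -mulgA; congr (y * _)%g.
    by apply: val_inj; rewrite /= ec mulVf.
  by exists (y * g gamma)%g; rewrite mulg1.
case=> e [eu AE]; right; exists e.
have hP a : `|h a| <= 1 by apply/AE; exists a.
pose g a := UnitDisk e (hP a).
exists g; split=> //; split.
- split=> [a b|a|]; apply: val_inj; rewrite /= ?hN ?h0 // hD eu.
  by rewrite -mulrA [2^-1 * _]mulrC.
- by split=> [|a b]; apply: val_inj; rewrite /= ?h1 ?hM.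
have gE (y : unit_disk e) : exists a, h a == disk_val y.
  by have /AE[a <-] := disk_valP y; exists a.
exists (fun y => xchoose (gE y)) => [a|y].
  by apply/hI/eqP; apply: (xchooseP (gE (g a))).
by apply: val_inj; apply/eqP; apply: (xchooseP (gE y)).
Qed.
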